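(* Let $p=12k+1$ be a prime, where $k$ is a positive integer, let $\alpha$ be a primitive element of $\mathbb{F}_p$, and let $C_i^6=\{\alpha^{6s+i}\mid 0\le s\le (p-1)/6-1\}$, $0\le i\le 5$, be the cyclotomic classes of order six in $\mathbb{F}_p$. Then the family $\mathcal D=\{C_0^6,C_2^6,C_4^6\}$ forms a $(p,3,(p-1)/6,(p-1)/6)$-EDF over $\mathbb{F}_p$ (that is, in the additive group of $\mathbb{F}_p$) if and only if $k$ is a square (of an integer).
   Context: External difference family (EDF): Let $G$ be an additive abelian group of order $n$ and let $\mathcal D=\{D_0,D_1,\dots,D_{m-1}\}$ be a family of pairwise disjoint subsets of $G$, each of size $\kappa$. For $i\ne j$ let $\Delta(D_i,D_j)=\{x-y\mid x\in D_i,\ y\in D_j\}$, regarded as a multiset. The family $\mathcal D$ is called an $(n,m,\kappa,\lambda)$-EDF if every nonzero element of $G$ appears exactly $\lambda$ times in the multiset union $\bigcup_{0\le i\ne j\le m-1}\Delta(D_i,D_j)$, taken over all ordered pairs $(i,j)$ with $i\ne j$. *)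

(* Defs.v *)
From HB Require Import structures.
From mathcomp Require Import all_boot all_order all_algebra all_fingroup.
From mathcomp Require Import all_solvable all_field.

Set Implicit Arguments.
Unset Strict Implicit.
Unset Printing Implicit Defensive.

Import GRing.Theory.
Local Open Scope ring_scope.

(* A list, not a set: the multiplicity of g is [count_mem g (Delta A B)]. *)
Definition Delta (G : finZmodType) (A B : {set G}) : seq G :=
  [seq x - y | x <- enum A, y <- enum B].

(* The multiplicity of g in the multiset union is the sum of its
   multiplicities, over the ordered pairs (i, j) with i <> j. *)
Definition is_EDF (G : finZmodType) (n m kappa lambda : nat)
    (D : 'I_m -> {set G}) : Prop :=
  [/\ #|G| = n,
      forall i, #|D i| = kappa,
      forall i j, i != j -> [disjoint D i & D j]
    & forall g : G, g != 0 ->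
        (\sum_(i < m) \sum_(j < m | i != j) count_mem g (Delta (D i) (D j)))%N
        = lambda].

Arguments is_EDF {G} n m kappa lambda D.

Definition primitive_element (F : finFieldType) (alpha : F) : Prop :=
  exists2 u : {unit F}, alpha = val u & generator [set: {unit F}] u.

Definition cyclotomic_class (F : finFieldType) (alpha : F) (e i : nat)
    : {set F} :=
  [set alpha ^+ (e * s + i)%N | s : 'I_((#|F| - 1) %/ e)].

(* Main.v *)
Require Import Defs.
From HB Require Import structures.
From mathcomp Require Import all_boot all_order all_algebra all_fingroup.
From mathcomp Require Import all_solvable all_field.
From mathcomp Require Import zify ring.
Import GRing.Theory Num.Theory.
Local Open Scope ring_scope.

Set Implicit Arguments.
Unset Strict Implicit.
Unset Printing Implicit Defensive.

(** Let [chi] be the quadratic character of the field [F] with [q = 12 k + 1]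
    elements and [J m] the sum of [chi (x ^+ 3 + m)] over [x] in [F].

    The three classes partition the nonzero squares, so the multiplicity [N g]
    of [g] counts the [y] such that [y] and [y + g] are squares in different
    classes.  Squares at distance [g]: expanding indicator functions in terms
    of [chi] gives [(12 k - 2 - 2 chi g) / 4] of them.  Squares at distance
    [g] in the same class: the ratio [u = 1 + g / y] is a sixth power
    and [chi (u - 1) = chi g]; with [u = v ^+ 6] the count reduces to the sum
    of [chi (v ^+ 6 - 1)] over nonzero [v], which splits into two equal cubic
    sums and equals [2 J 1 - 2].  Altogether
    [6 N g = 12 k - chi g * (J 1 + 2)] (lemma [multiplicity_formula]), and the
    family is a difference family iff [J 1 = -2].

    It remains to see when [J 1 = -2].  The values of [J] on the three cosets
    of the cubes have, up to sign, sum [0], and their squares have sum [6 q];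
    eliminating one of them gives [J 1 ^+ 2 + 3 e ^+ 2 = 4 q] for some integer
    [e] (lemma [cubic_jacobsthal_norm]).  Moreover [J 1] is [-2] modulo 6.  If
    [J 1 = -2], then [3 e ^+ 2 = 48 k], so [k] is a square.  Conversely, if
    [k = b ^+ 2], then [p = 1 + 3 (2 b) ^+ 2]; a prime has at most one
    representation as [x ^+ 2 + 3 y ^+ 2] up to signs, so [J 1] is [2] or
    [-2], and the congruence modulo 6 leaves [-2]. *)

(** * Powers in a finite field *)

Section PowerMaps.

Variables (F : finFieldType) (alpha : F).
Hypothesis alpha_prim : #|F|.-1.-primitive_root alpha.

Lemma card_units_gt0 : (0 < #|F|.-1)%N.
Proof. exact: prim_order_gt0 alpha_prim. Qed.

Lemma prim_root_neq0 : alpha != 0.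
Proof.
apply/eqP => alpha0; have := prim_expr_order alpha_prim.
rewrite alpha0 expr0n; have := card_units_gt0.
by case: #|F|.-1 => //= n _ /esym/eqP; rewrite oner_eq0.
Qed.

Lemma expf_card_units (x : F) : x != 0 -> x ^+ #|F|.-1 = 1.
Proof.
move=> x_n0; apply: (mulfI x_n0); rewrite mulr1 -exprS prednK ?expf_card //.
by have := card_units_gt0; case: #|F|.
Qed.

Lemma nonzero_power (x : F) :
  x != 0 -> exists2 i, (i < #|F|.-1)%N & x = alpha ^+ i.
Proof.
by move=> /expf_card_units /(prim_rootP alpha_prim) [i ->]; exists i.
Qed.

Lemma sum_nonzero_powers (V : nmodType) (f : F -> V) :
  \sum_(x | x != 0) f x = \sum_(i < #|F|.-1) f (alpha ^+ i).
Proof.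
have inj : {in 'I_(#|F|.-1) &, injective (fun i : 'I_(#|F|.-1) => alpha ^+ i)}.
  move=> i j _ _ /eqP; rewrite (eq_prim_root_expr alpha_prim).
  by rewrite !modn_small // => /eqP/val_inj.
rewrite -(big_imset f inj) /=; apply: eq_bigl => x.
apply/idP/imsetP => [/nonzero_power [i lt_i ->] | [i _ ->]].
  by exists (Ordinal lt_i).
by rewrite expf_neq0 // prim_root_neq0.
Qed.

Lemma card_nonzero : #|[pred x : F | x != 0]| = #|F|.-1.
Proof.
rewrite -sum1_card (sum_nonzero_powers (fun=> 1%N)).
by rewrite sum1_card card_ord.
Qed.

(** Dividing by one solution turns the equation [v ^+ e = c] into
    [v ^+ e = 1], whose solutions are the powers of [alpha ^+ h]. *)
Lemma card_same_power (e h : nat) (v0 : F) :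
  (e * h)%N = #|F|.-1 -> v0 != 0 -> #|[pred v | v ^+ e == v0 ^+ e]| = e.
Proof.
move=> eh v0_n0; have eh_gt0 : (0 < e * h)%N by rewrite eh card_units_gt0.
have h_gt0 : (0 < h)%N by lia.
have prim_e : e.-primitive_root (alpha ^+ h).
  have := dvdn_prim_root alpha_prim (m := e).
  by rewrite -eh mulKn ?dvdn_mulr //; [apply | lia].
have inj : {in 'I_e &, injective (fun i : 'I_e => v0 * (alpha ^+ h) ^+ i)}.
  move=> i j _ _ /(mulfI v0_n0) /eqP; rewrite (eq_prim_root_expr prim_e).
  by rewrite !modn_small // => /eqP/val_inj.
rewrite -[RHS]card_ord -(card_in_imset inj); apply: eq_card => v.
rewrite !inE; apply/eqP/imsetP => [eq_v | [i _ ->]]; last first.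
  by rewrite exprMn (exprAC _ i e) (prim_expr_order prim_e) expr1n mulr1.
have /(prim_rootP prim_e) [i def_i] : (v / v0) ^+ e = 1.
  by rewrite expr_div_n eq_v divff // expf_neq0.
by exists i => //; rewrite -def_i mulrC divfK.
Qed.

Lemma is_power (e h : nat) (u : F) :
  (e * h)%N = #|F|.-1 -> u != 0 -> (u ^+ h == 1) -> exists v, v ^+ e = u.
Proof.
move=> eh /nonzero_power [i _ ->].
rewrite -exprM -(prim_order_dvd alpha_prim) -eh.
have eh_gt0 : (0 < e * h)%N by rewrite eh card_units_gt0.
rewrite dvdn_pmul2r; last by lia.
by move=> /dvdnP [j ->]; exists (alpha ^+ j); rewrite -exprM.
Qed.

(** The map [v |-> v ^+ e] is [e]-to-one from the nonzero elements onto the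
    subgroup of order [h]. *)
Lemma sum_power_map (e h : nat) (V : nmodType) (f : F -> V) :
  (e * h)%N = #|F|.-1 ->
  \sum_(v | v != 0) f (v ^+ e) = (\sum_(u | u ^+ h == 1) f u) *+ e.
Proof.
move=> eh; have eh_gt0 : (0 < e * h)%N by rewrite eh card_units_gt0.
have [e_gt0 h_gt0] : (0 < e)%N /\ (0 < h)%N by lia.
rewrite (partition_big (fun v => v ^+ e) (fun u => u ^+ h == 1)) /=; last first.
  by move=> v /expf_card_units; rewrite -exprM eh => ->.
rewrite -sumrMnl; apply: eq_bigr => u uh1.
have u_n0 : u != 0.
  by apply: contraTneq uh1 => ->; rewrite expr0n gtn_eqF // eq_sym oner_eq0.
have [v0 def_u] := is_power eh u_n0 uh1.
have v0_n0 : v0 != 0.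
  by apply: contraNneq u_n0 => v0_0; rewrite -def_u v0_0 expr0n gtn_eqF.
rewrite (eq_bigr (fun=> f u)) => [|v /andP[_ /eqP ->] //].
rewrite sumr_const; congr (_ *+ _).
rewrite -[RHS](card_same_power eh v0_n0); apply: eq_card => v.
rewrite !inE def_u unfold_in /= andb_idl // => /eqP vu.
by apply: contraNneq u_n0 => v_0; rewrite -vu v_0 expr0n gtn_eqF.
Qed.

End PowerMaps.

(** * The quadratic character *)

(** Defined by Euler's criterion, which makes multiplicativity immediate. *)
Definition quad_char {F : finFieldType} (x : F) : int :=
  if x == 0 then 0 else if x ^+ (#|F|.-1)./2 == 1 then 1 else -1.

Section QuadraticCharacter.

Variables (F : finFieldType) (alpha : F).
Hypothesis alpha_prim : #|F|.-1.-primitive_root alpha.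
Hypothesis F_odd : odd #|F|.

Local Notation chi := (@quad_char F).
Local Notation h := (#|F|.-1)./2.

Lemma double_half_order : (2 * h)%N = #|F|.-1.
Proof. by move: F_odd; case: #|F| => //= n n_even; lia. Qed.

Lemma half_order_gt0 : (0 < h)%N.
Proof.
by have := double_half_order; have := card_units_gt0 alpha_prim; lia.
Qed.

Lemma quad_char0 : chi 0 = 0.
Proof. by rewrite /quad_char eqxx. Qed.

Lemma quad_char1 : chi 1 = 1.
Proof. by rewrite /quad_char oner_eq0 expr1n eqxx. Qed.

Lemma prim_root_half : alpha ^+ h = -1.
Proof.
apply/eqP; have := sqrf_eq1 (alpha ^+ h).
rewrite -exprM mulnC double_half_order (prim_expr_order alpha_prim) eqxx.
rewrite -(prim_order_dvd alpha_prim) => /esym/orP [/dvdn_leq|//].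
by have := double_half_order; have := half_order_gt0; lia.
Qed.

Lemma oppr1_neq1 : -1 != 1 :> F.
Proof.
rewrite -prim_root_half -(prim_order_dvd alpha_prim).
apply/negP => /dvdn_leq.
by have := double_half_order; have := half_order_gt0; lia.
Qed.

(** Euler's criterion read back in the field: the power of [x] squares to [1],
    so it is one of the two values of [chi]. *)
Lemma half_power (x : F) : x != 0 -> x ^+ h = (chi x)%:~R.
Proof.
move=> x_n0; rewrite /quad_char (negPf x_n0).
have := sqrf_eq1 (x ^+ h).
rewrite -exprM mulnC double_half_order (expf_card_units alpha_prim) //.
by rewrite eqxx; case: eqP => //= _ /esym/eqP ->.
Qed.

Lemma quad_char_cases (x : F) : x != 0 -> chi x = 1 \/ chi x = -1.
Proof.
by move=> x_n0; rewrite /quad_char (negPf x_n0); case: eqP => _; [left|right].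
Qed.

Lemma quad_char_sqr (x : F) : chi x * chi x = (x != 0)%:R.
Proof.
have [->|x_n0] := eqVneq x 0; first by rewrite quad_char0.
by case: (quad_char_cases x_n0) => ->.
Qed.

Lemma quad_charM (x y : F) : chi (x * y) = chi x * chi y.
Proof.
have [->|x_n0] := eqVneq x 0; first by rewrite mul0r quad_char0 mul0r.
have [->|y_n0] := eqVneq y 0; first by rewrite mulr0 quad_char0 mulr0.
have xy_n0 : x * y != 0 by rewrite mulf_neq0.
have := exprMn h x y; rewrite !half_power // -intrM.
case: (quad_char_cases xy_n0) => ->; case: (quad_char_cases x_n0) => ->;
  case: (quad_char_cases y_n0) => -> //= /eqP;
  by rewrite ?(eq_sym 1) (negPf oppr1_neq1).
Qed.

Lemma quad_charX (x : F) (n : nat) : chi (x ^+ n) = chi x ^+ n.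
Proof.
by elim: n => [|n IHn]; rewrite ?quad_char1 // !exprS quad_charM IHn.
Qed.

Lemma quad_charV (x : F) : chi x^-1 = chi x.
Proof.
have [->|x_n0] := eqVneq x 0; first by rewrite invr0.
have := quad_charM x x^-1; rewrite divff // quad_char1.
case: (quad_char_cases x_n0) => ->; first by rewrite mul1r.
by rewrite mulN1r => ->; rewrite opprK.
Qed.

Lemma quad_char_eq1 (x : F) : (chi x == 1) = (x ^+ h == 1).
Proof.
have [->|x_n0] := eqVneq x 0.
  by rewrite quad_char0 expr0n gtn_eqF ?half_order_gt0 //= [RHS]eq_sym oner_eq0.
by rewrite /quad_char (negPf x_n0); case: (x ^+ h == 1).
Qed.

Lemma quad_char_prim_root : chi alpha = -1.
Proof.
rewrite /quad_char (negPf (prim_root_neq0 alpha_prim)).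
by rewrite prim_root_half (negPf oppr1_neq1).
Qed.

Lemma quad_charN1 : (4 %| #|F|.-1)%N -> chi (-1) = 1.
Proof.
move=> dvd4; rewrite -prim_root_half quad_charX quad_char_prim_root.
by rewrite -signr_odd (_ : odd h = false) //; lia.
Qed.

Lemma sum_quad_char : \sum_x chi x = 0.
Proof.
suff: \sum_x chi x = - \sum_x chi x by lia.
rewrite {1}(reindex_inj (mulfI (prim_root_neq0 alpha_prim))) -sumrN.
by apply: eq_bigr => x _; rewrite quad_charM quad_char_prim_root mulN1r.
Qed.

(** Counts over pairs [x], [x + b] become counts over their ratio. *)
Lemma sum_shifted_ratio (V : nmodType) (f : F -> V) (b : F) :
  b != 0 -> \sum_(x | x != 0) f (1 + b / x) = \sum_(u | u != 1) f u.
Proof.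
move=> b_n0.
have bij : {on [pred u : F | u != 1], bijective (fun x : F => 1 + b / x)}.
  exists (fun u => b / (u - 1)) => u.
    by move=> _; rewrite addrC addKr invf_div mulrCA divff ?mulr1.
  rewrite !inE => u_n1; have u1_n0 : u - 1 != 0 by rewrite subr_eq0.
  by rewrite invf_div mulrCA divff // mulr1 addrC subrK.
rewrite [RHS](reindex _ bij) /=; apply: eq_bigl => x.
rewrite -[1 + _ == 1]subr_eq0 addrAC subrr add0r mulf_eq0 invr_eq0.
by rewrite (negPf b_n0).
Qed.

(** Away from [x = 0] the summand is [chi (1 + b / x)], and [1 + b / x] takes
    every value but [1]. *)
Lemma sum_quad_char_shift (b : F) :
  b != 0 -> \sum_x chi x * chi (x + b) = -1.
Proof.
move=> b_n0; rewrite (bigD1 0) //= quad_char0 mul0r add0r.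
have := sum_quad_char; rewrite (bigD1 1) //= quad_char1.
rewrite -(sum_shifted_ratio _ b_n0) addrC => /eqP; rewrite addr_eq0 => /eqP <-.
apply: eq_bigr => x x_n0.
by rewrite -(quad_charV x) -quad_charM mulrDr mulVf // [x^-1 * b]mulrC.
Qed.

(** A nonzero [u] has [1 + chi u] square roots. *)
Lemma sum_squares (f : F -> int) :
  \sum_(v | v != 0) f (v ^+ 2) = \sum_(u | u != 0) (1 + chi u) * f u.
Proof.
rewrite (sum_power_map alpha_prim f double_half_order).
rewrite [RHS](bigID (fun u => u ^+ h == 1)) /= [X in _ + X]big1 ?addr0.
  rewrite -sumrMnl; apply: eq_big => u.
    rewrite andb_idl // => /eqP uh1; apply/eqP => u_0; move/eqP: uh1.
    by rewrite u_0 expr0n gtn_eqF ?half_order_gt0 //= eq_sym oner_eq0.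
  by rewrite -quad_char_eq1 => /eqP ->; rewrite -mulr_natl.
move=> u /andP[u_n0]; rewrite -quad_char_eq1.
by case: (quad_char_cases u_n0) => ->; rewrite ?eqxx // subrr mul0r.
Qed.

End QuadraticCharacter.

(** * Cubic Jacobsthal sums *)

Lemma sum_indicator (T : finType) (P : pred T) :
  \sum_x (P x)%:R = #|P|%:R :> int.
Proof.
by rewrite -natr_sum -sum1_card [in RHS]big_mkcond.
Qed.

(** Up to sign, the trace of Frobenius of the curve [y ^ 2 = x ^ 3 + m] when
    that curve is elliptic. *)
Definition cubic_jacobsthal {F : finFieldType} (m : F) : int :=
  \sum_x quad_char (x ^+ 3 + m).

(** Eliminating [c] leaves [a ^+ 2 - a * b + b ^+ 2 = 3 r], a norm from the
    Eisenstein integers; completing the square makes [a - 2 b] a multiple of 3. *)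
Lemma norm_form_of_sums (a b c r : int) :
  a - b + c = 0 -> a ^+ 2 + b ^+ 2 + c ^+ 2 = 6 * r ->
  exists e, a ^+ 2 + 3 * e ^+ 2 = 4 * r.
Proof.
move=> sum_abc sqr_abc; have def_c : c = b - a by lia.
have eq12 : (a - 2 * b) ^+ 2 = 3 * (4 * r - a ^+ 2).
  by rewrite def_c in sqr_abc; lia.
have [e def_e] : exists e, a - 2 * b = 3 * e.
  have : (3 %| (a - 2 * b) ^+ 2)%Z by rewrite eq12 dvdz_mulr.
  by rewrite dvdzE abszX Euclid_dvdX // andbT => /dvdzP [e ->]; exists e; ring.
by exists e; rewrite def_e in eq12; lia.
Qed.

Section CubicJacobsthalSums.

Variables (F : finFieldType) (alpha : F) (n : nat).
Hypothesis alpha_prim : #|F|.-1.-primitive_root alpha.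
Hypothesis F_odd : odd #|F|.
Hypothesis card_3n : (3 * n)%N = #|F|.-1.

Local Notation chi := (@quad_char F).
Local Notation J := (@cubic_jacobsthal F).
Local Notation q := (#|F|%:R : int).

Let chiM := quad_charM alpha_prim F_odd.

Lemma card_units_int : #|F|.-1%:R = q - 1 :> int.
Proof. by have := half_order_gt0 alpha_prim F_odd; rewrite !natz; lia. Qed.

Lemma cubic_jacobsthal_mul_cube (m t : F) :
  t != 0 -> J (m * t ^+ 3) = chi t * J m.
Proof.
move=> t_n0; rewrite /cubic_jacobsthal mulr_sumr (reindex_inj (mulfI t_n0)) /=.
apply: eq_bigr => x _; rewrite exprMn [m * _]mulrC -mulrDr chiM.
rewrite (quad_charX alpha_prim F_odd) exprS expr2 quad_char_sqr t_n0.
by rewrite mulr1.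
Qed.

Lemma cubic_jacobsthal0 : J 0 = 0.
Proof.
rewrite -(sum_quad_char alpha_prim F_odd); apply: eq_bigr => x _.
rewrite addr0 (quad_charX alpha_prim F_odd) exprS expr2 quad_char_sqr.
by have [->|_] := eqVneq x 0; rewrite ?quad_char0 ?mul0r ?mulr1.
Qed.

(** The translates of [chi] are nearly orthogonal. *)
Lemma quad_char_orthogonality (a b : F) :
  \sum_m chi (a + m) * chi (b + m) = q * (a == b)%:R - 1.
Proof.
rewrite (reindex_inj (addrI (- a))) /=.
rewrite (eq_bigr (fun m => chi m * chi (m + (b - a)))) => [|m _]; last first.
  by rewrite addNKr addrA [_ - a + m]addrC.
have [->|neq_ab] := eqVneq a b; last first.
  rewrite mulr0 sub0r (sum_quad_char_shift alpha_prim F_odd) //.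
  by rewrite subr_eq0 eq_sym.
rewrite (eq_bigr (fun m : F => (m != 0)%:R)) => [|m _]; last first.
  by rewrite subrr addr0 quad_char_sqr.
rewrite sum_indicator (card_nonzero alpha_prim) mulr1.
exact: card_units_int.
Qed.

(** Zero is paired with itself only, and any other [x] with its products by
    the three cube roots of unity: [1 + 3 (q - 1)] pairs. *)
Lemma card_equal_cubes : \sum_(x : F) \sum_(y : F) (x ^+ 3 == y ^+ 3)%:R
  = 3 * q - 2 :> int.
Proof.
rewrite (bigD1 0) //= [X in X + _ = _](bigD1 0) //= eqxx big1 => [|y y_n0].
  rewrite (eq_bigr (fun=> 3)) => [|x x_n0].
    rewrite sumr_const (card_nonzero alpha_prim) -[X in _ + X]mulr_natr.
    by rewrite card_units_int /=; ring.
  rewrite sum_indicator -[RHS](congr1 (GRing.natmul 1)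
    (card_same_power alpha_prim card_3n x_n0)).
  by congr _%:R; apply: eq_card => y; rewrite !inE eq_sym.
by rewrite expr0n /= eq_sym expf_eq0 /= (negPf y_n0).
Qed.

Lemma sum_cubic_jacobsthal_sqr : \sum_m J m ^+ 2 = 2 * q * (q - 1).
Proof.
under eq_bigr => m _ do rewrite expr2 /cubic_jacobsthal big_distrlr /=.
rewrite exchange_big /=; under eq_bigr => x _ do rewrite exchange_big /=.
under eq_bigr => x _ do under eq_bigr => y _ do
  rewrite quad_char_orthogonality.
under eq_bigr => x _ do rewrite sumrB -mulr_sumr sumr_const.
by rewrite sumrB -mulr_sumr card_equal_cubes sumr_const; ring.
Qed.

Lemma sum_quad_char_cubic_jacobsthal : \sum_m chi m * J m = 0.
Proof.
under eq_bigr => m _ do rewrite mulr_sumr.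
rewrite exchange_big /=.
rewrite (eq_bigr (fun x : F => q * (x == 0)%:R - 1)) => [|x _].
  by rewrite sumrB -mulr_sumr sum_indicator card1 sumr_const; ring.
have <- : (0 == x ^+ 3) = (x == 0) by rewrite eq_sym expf_eq0.
by rewrite -quad_char_orthogonality; apply: eq_bigr => m _; rewrite add0r.
Qed.

(** The cosets of the cubes are represented by [1], [alpha], [alpha ^+ 2]. *)
Lemma sum_cubic_classes (V : nmodType) (f : F -> V) :
  (forall m t, t != 0 -> f (m * t ^+ 3) = f m) ->
  \sum_(m | m != 0) f m = (f 1 + f alpha + f (alpha ^+ 2)) *+ n.
Proof.
move=> f_cube; rewrite (sum_nonzero_powers alpha_prim) -card_3n.
elim: n => [|j IHj]; first by rewrite muln0 big_ord0.
have fE i : f (alpha ^+ (i + 3 * j)) = f (alpha ^+ i).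
  rewrite exprD mulnC exprM f_cube // expf_neq0 //.
  exact: prim_root_neq0 alpha_prim.
rewrite mulnS !big_ord_recr /= IHj (fE 0) (fE 1) (fE 2) expr0 expr1.
by rewrite mulrSr !addrA.
Qed.

Let n_gt0 : (0 < n)%N.
Proof. by have := card_units_gt0 alpha_prim; lia. Qed.

Let qE : q = 3 * n%:R + 1.
Proof. by rewrite -[q](subrK 1) -card_units_int -card_3n natrM. Qed.

(** [J m ^+ 2] and [chi m * J m] are constant on the cosets of the cubes, so
    their sums over the field are relations between three values of [J]. *)
Lemma cubic_jacobsthal_sqr_classes :
  J 1 ^+ 2 + J alpha ^+ 2 + J (alpha ^+ 2) ^+ 2 = 6 * q.
Proof.
have := sum_cubic_jacobsthal_sqr; rewrite (bigD1 0) //= cubic_jacobsthal0.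
rewrite (sum_cubic_classes (f := fun m => J m ^+ 2)) => [|m t t_n0].
  rewrite expr0n add0r /= => eqn.
  have nZ_n0 : n%:R != 0 :> int by rewrite pnatr_eq0 -lt0n.
  by apply: (mulfI nZ_n0); rewrite [LHS]mulr_natl eqn qE; ring.
by rewrite cubic_jacobsthal_mul_cube // exprMn expr2 quad_char_sqr t_n0 mul1r.
Qed.

Lemma cubic_jacobsthal_sum_classes : J 1 - J alpha + J (alpha ^+ 2) = 0.
Proof.
have := sum_quad_char_cubic_jacobsthal.
rewrite (bigD1 0) //= cubic_jacobsthal0 mulr0 add0r.
rewrite (sum_cubic_classes (f := fun m => chi m * J m)) => [|m t t_n0].
  have chi_alpha := quad_char_prim_root alpha_prim F_odd.
  rewrite quad_char1 (quad_charX alpha_prim F_odd) chi_alpha.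
  move/eqP; rewrite -mulr_natr mulf_eq0 pnatr_eq0 (gtn_eqF n_gt0) orbF.
  by rewrite mul1r mulN1r sqrrN expr1n mul1r => /eqP.
rewrite cubic_jacobsthal_mul_cube // chiM (quad_charX alpha_prim F_odd).
by case: (quad_char_cases t_n0) => ->; ring.
Qed.

Lemma cubic_jacobsthal_norm :
  exists e : int, J 1 ^+ 2 + 3 * e ^+ 2 = 4 * q.
Proof.
apply: norm_form_of_sums cubic_jacobsthal_sum_classes _.
exact: cubic_jacobsthal_sqr_classes.
Qed.

(** Modulo 3, the nonzero [x] contribute nothing because [x ^+ 3] takes each
    of its values three times; modulo 2, each of the [q - 3] nonzero terms
    counts for 1, and [q] is odd. *)
Lemma cubic_jacobsthal1_mod6 : exists c : int, J 1 = 6 * c - 2.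
Proof.
have mod3 : exists c, J 1 = 1 + 3 * c.
  exists (\sum_(u : F | u ^+ n == 1) chi (u + 1)).
  rewrite /cubic_jacobsthal (bigD1 0) //= expr0n add0r quad_char1.
  rewrite (sum_power_map alpha_prim (fun u => chi (u + 1)) card_3n).
  by rewrite [3 * _]mulr_natl.
have mod2 : exists c, J 1 = q - 3 - 2 * c.
  exists (\sum_(x : F) (chi (x ^+ 3 + 1) == -1)%:R).
  have card3 : \sum_(x : F) (x ^+ 3 + 1 != 0)%:R = q - 3 :> int.
    rewrite sum_indicator.
    have N1_n0 : -1 != 0 :> F by rewrite oppr_eq0 oner_eq0.
    have := card_same_power alpha_prim card_3n N1_n0.
    rewrite -(cardC [pred x : F | x ^+ 3 == (-1) ^+ 3]) => ->.
    rewrite natrD addrAC subrr add0r; congr _%:R; apply: eq_card => x.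
    by rewrite !inE -signr_odd expr1 -addr_eq0.
  rewrite -card3 mulr_sumr -sumrB; apply: eq_bigr => x _.
  have [->|y_n0] := eqVneq (x ^+ 3 + 1) 0; first by rewrite quad_char0.
  by case: (quad_char_cases y_n0) => ->.
have q_odd : exists c, q = 1 + 2 * c.
  exists (#|F|./2)%:R.
  by rewrite -[in LHS](odd_double_half #|F|) F_odd natrD -mul2n natrM.
case: mod3 mod2 q_odd => c -> [d eq_d] [f eq_f]; rewrite eq_f in eq_d.
by exists (f - d - c - 1); lia.
Qed.

Hypothesis dvd4_units : (4 %| #|F|.-1)%N.

Let chiN1 := quad_charN1 alpha_prim F_odd dvd4_units.

Lemma quad_charN (x : F) : chi (- x) = chi x.
Proof. by rewrite -mulN1r chiM chiN1 mul1r. Qed.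

Lemma sum_quad_char_cubic : \sum_(u | u != 0) chi (u ^+ 3 - 1) = J 1 - 1.
Proof.
have N1_n0 : -1 != 0 :> F by rewrite oppr_eq0 oner_eq0.
have := cubic_jacobsthal_mul_cube 1 N1_n0.
rewrite chiN1 !mul1r -signr_odd expr1 => <-.
rewrite /cubic_jacobsthal [in RHS](bigD1 0) //= expr0n add0r chiN1.
by rewrite addrAC subrr add0r.
Qed.

(** Summing over squares [u = v ^+ 2] splits the sum into an untwisted cubic
    sum and one twisted by [chi u]; the substitution of [u^-1] for [u] turns
    the second into the first. *)
Lemma sum_quad_char_sextic :
  \sum_(v | v != 0) chi (v ^+ 6 - 1) = 2 * J 1 - 2.
Proof.
have twist : \sum_(u | u != 0) chi u * chi (u ^+ 3 - 1) = J 1 - 1.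
  rewrite -sum_quad_char_cubic (reindex_inj invr_inj) /=.
  apply: eq_big => [u|u]; rewrite invr_eq0 // => u_n0.
  have -> : u^-1 ^+ 3 - 1 = - ((u ^+ 3 - 1) * u^-1 ^+ 3).
    by rewrite mulrBl mul1r -exprMn divff // expr1n opprB.
  rewrite quad_charN chiM (quad_charX alpha_prim F_odd).
  rewrite !(quad_charV alpha_prim F_odd).
  by case: (quad_char_cases u_n0) => ->; ring.
under eq_bigr => v _ do rewrite (exprM v 2 3).
rewrite (sum_squares alpha_prim F_odd (fun u => chi (u ^+ 3 - 1))).
under eq_bigr => u _ do rewrite mulrDl mul1r.
by rewrite big_split /= twist sum_quad_char_cubic; ring.
Qed.

End CubicJacobsthalSums.

(** * Representations of a prime by the form x^2 + 3 y^2 *)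

(** From the two representations, [p] divides
    [3 (a B - f) (a B + f) = p (a ^+ 2 - 1)].  As [p] is not [3], it divides
    [a B - f] or [a B + f], and the sign of [f] is free.  In the identity
    [p ^+ 2 = (a + 3 B f) ^+ 2 + 3 (a B - f) ^+ 2] the multiple [a B - f]
    of [p] can only be zero. *)
Lemma norm_form_unique (p : nat) (B a f : int) :
  prime p -> p%:Z = 1 + 3 * B ^+ 2 -> p%:Z = a ^+ 2 + 3 * f ^+ 2 ->
  a ^+ 2 = 1.
Proof.
move=> p_prime pB paf.
have p_gt1 := prime_gt1 p_prime.
wlog dvd : f paf / (p %| a * B - f)%Z => [th|].
  have : (p %| 3 * ((a * B - f) * (a * B + f)))%Z.
    have -> : 3 * ((a * B - f) * (a * B + f))
      = a ^+ 2 * (3 * B ^+ 2) - 3 * f ^+ 2 by ring.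
    have -> : 3 * B ^+ 2 = p%:Z - 1 by lia.
    have -> : 3 * f ^+ 2 = p%:Z - a ^+ 2 by lia.
    by apply/dvdzP; exists (a ^+ 2 - 1); ring.
  have p_ndvd3 : ~~ (p %| 3)%N.
    apply/negP => /dvdn_leq -/(_ isT) p_le3.
    by move: (B ^+ 2) pB => s; lia.
  rewrite !dvdzE !abszM !Euclid_dvdM // (negPf p_ndvd3) /=.
  case/orP => dvd; first exact: (th f).
  by apply: (th (- f)); rewrite ?sqrrN ?opprK.
have [t def_t] := dvdzP dvd.
have p_sqr : p%:Z ^+ 2 = (a + 3 * B * f) ^+ 2 + 3 * (a * B - f) ^+ 2.
  by rewrite expr2 {1}pB paf; ring.
have t0 : t = 0.
  apply/eqP; apply: contraT => t_n0.
  have t_ge1 : 1 <= t ^+ 2 by rewrite -gtz0_ge1 exprn_even_gt0.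
  have p2_gt0 : 0 < p%:Z ^+ 2 by rewrite exprn_gt0 // ltz_nat prime_gt0.
  have : p%:Z ^+ 2 <= t ^+ 2 * p%:Z ^+ 2 by rewrite ler_peMl // ltW.
  have : 3 * (t ^+ 2 * p%:Z ^+ 2) <= p%:Z ^+ 2.
    by rewrite -exprMn -def_t p_sqr lerDr sqr_ge0.
  move: (p%:Z ^+ 2) (t ^+ 2) p2_gt0 => P T; lia.
have def_f : f = a * B.
  by apply/eqP; rewrite eq_sym -subr_eq0 def_t t0 mul0r.
have : (a ^+ 2 - 1) * p%:Z = 0.
  by rewrite mulrBl mul1r {1}pB paf def_f; ring.
by move/eqP; rewrite mulf_eq0 subr_eq0 => /orP[/eqP //|]; lia.
Qed.

(** The congruence on [a] makes [a] and [e] even, which brings the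
    representation of [4 p] down to one of [p], and tells [-2] from [2]. *)
Lemma eq_m2_iff_square (p k : nat) (a e : int) :
  prime p -> p = (12 * k + 1)%N -> (exists c, a = 6 * c - 2) ->
  a ^+ 2 + 3 * e ^+ 2 = 4 * p%:Z ->
  a = -2 <-> exists b : int, k%:Z = b ^+ 2.
Proof.
move=> p_prime p_eq [c a_eq] norm_p; split => [a_m2 | [b k_eq]].
  rewrite a_m2 p_eq in norm_p.
  have [f e_eq] : exists f, e = 4 * f.
    exists (e %/ 4)%Z; have := divz_eq e 4.
    have : 0 <= (e %% 4)%Z < 4 by rewrite modz_ge0 // ltz_pmod.
    move: (e %/ 4)%Z (e %% 4)%Z => s r r_bound e_eq.
    have e2 : e ^+ 2 = 16 * k%:Z by lia.
    have r2 : r ^+ 2 = 8 * (2 * k%:Z - 2 * s ^+ 2 - s * r).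
      by rewrite e_eq in e2; lia.
    have [r0|[r1|[r2'|r3]]] : r = 0 \/ r = 1 \/ r = 2 \/ r = 3 by lia.
    - by rewrite e_eq r0; ring.
    - by rewrite r1 in r2; lia.
    - by rewrite r2' in r2; lia.
    - by rewrite r3 in r2; lia.
  by exists f; rewrite e_eq in norm_p; lia.
have [f e_eq] : exists f, e = 2 * f.
  exists (e %/ 2)%Z; have := divz_eq e 2.
  have : 0 <= (e %% 2)%Z < 2 by rewrite modz_ge0 // ltz_pmod.
  move: (e %/ 2)%Z (e %% 2)%Z => s r r_bound e_eq.
  have [r0|r1] : r = 0 \/ r = 1 by lia.
    by rewrite e_eq r0; ring.
  by rewrite e_eq a_eq r1 in norm_p; lia.
have half_norm : p%:Z = (3 * c - 1) ^+ 2 + 3 * f ^+ 2.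
  by rewrite a_eq e_eq in norm_p; lia.
have p_b : p%:Z = 1 + 3 * (2 * b) ^+ 2 by rewrite exprMn -k_eq p_eq; lia.
have := norm_form_unique p_prime p_b half_norm.
by move/eqP; rewrite sqrf_eq1 => /orP[] /eqP; lia.
Qed.

(** * Differences between sextic classes *)

Lemma count_mem_Delta (G : finZmodType) (A B : {set G}) (g : G) :
  (count_mem g (Delta A B))%:R
    = \sum_y (y \in B)%:R * (y + g \in A)%:R :> int.
Proof.
have -> : count_mem g (Delta A B)
    = (\sum_(x in A) \sum_(y in B) (x == (y + g)%R))%N.
  rewrite -sum1_count big_mkcond big_allpairs_dep big_enum /=.
  apply: eq_bigr => x _; rewrite big_enum /=; apply: eq_bigr => y _.
  by rewrite subr_eq [y + g]addrC; case: (x == g + y).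
rewrite exchange_big natr_sum big_mkcond; apply: eq_bigr => y _ /=.
case: (y \in B); last by rewrite mul0r.
rewrite mul1r; congr _%:R; case: (boolP (y + g \in A)) => [in_A | notin_A].
  by rewrite (bigD1 (y + g)) //= eqxx big1 // => x /andP[_ /negPf ->].
rewrite big1 // => x x_A; case: eqP => // x_eq.
by rewrite -x_eq x_A in notin_A.
Qed.

Lemma sum_delta (T : finType) (a : T) (f : T -> int) :
  \sum_x (x == a)%:R * f x = f a.
Proof.
rewrite (bigD1 a) //= eqxx mul1r big1 ?addr0 // => x /negPf ->.
by rewrite mul0r.
Qed.

Section SexticClasses.

Variables (F : finFieldType) (alpha : F) (k : nat).
Hypothesis alpha_prim : #|F|.-1.-primitive_root alpha.
Hypothesis card_F : #|F| = (12 * k + 1)%N.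

Local Notation chi := (@quad_char F).
Local Notation J := (@cubic_jacobsthal F).
Local Notation D := (fun i : 'I_3 => cyclotomic_class alpha 6 (2 * i)).
Local Notation zeta := (alpha ^+ (4 * k)).

Let card_units : #|F|.-1 = (12 * k)%N. Proof. by rewrite card_F addn1. Qed.
Let k_gt0 : (0 < k)%N.
Proof. by have := card_units_gt0 alpha_prim; rewrite card_units; lia. Qed.
Let F_odd : odd #|F|. Proof. by rewrite card_F; lia. Qed.
Let dvd4 : (4 %| #|F|.-1)%N. Proof. by rewrite card_units; lia. Qed.
Let card_3 : (3 * (4 * k))%N = #|F|.-1. Proof. by rewrite card_units; lia. Qed.
Let card_6 : (6 * (2 * k))%N = #|F|.-1. Proof. by rewrite card_units; lia. Qed.
Let half_F : (#|F|.-1)./2 = (6 * k)%N. Proof. by rewrite card_units; lia. Qed.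
Let chiN := quad_charN alpha_prim F_odd dvd4.
Let chiM := quad_charM alpha_prim F_odd.

Lemma zeta_prim : 3.-primitive_root zeta.
Proof.
have := dvdn_prim_root alpha_prim (m := 3).
by rewrite -card_3 mulKn // dvdn_mulr //; apply.
Qed.

(** The characterization by [x ^+ (2 * k)], a cube root of unity when [x] is a
    square, makes lying in the same class an equation that is homogeneous
    in the pair. *)
Lemma mem_cyclotomic_class (i : 'I_3) (x : F) :
  (x \in cyclotomic_class alpha 6 (2 * i)) = (x ^+ (2 * k) == zeta ^+ i).
Proof.
have alpha_n0 := prim_root_neq0 alpha_prim.
rewrite -exprM; apply/imsetP/eqP => [[s _ ->] | x_eq].
  apply/eqP; rewrite -exprM (eq_prim_root_expr alpha_prim) card_units.
  have -> : ((6 * s + 2 * i) * (2 * k) = s * (12 * k) + 4 * k * i)%N by lia.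
  by rewrite modnMDl.
have x_n0 : x != 0.
  apply: contraTneq isT => x_0; move/eqP: x_eq.
  rewrite x_0 expr0n gtn_eqF ?muln_gt0 // eq_sym expf_eq0.
  by rewrite (negPf alpha_n0) andbF.
have [j lt_j x_j] := nonzero_power alpha_prim x_n0.
have j_eq : j = (6 * (j %/ 6) + 2 * i)%N.
  move/eqP: x_eq; rewrite x_j -exprM (eq_prim_root_expr alpha_prim) -card_6.
  have -> : (j * (2 * k) = (2 * k) * j)%N by lia.
  have -> : (4 * k * i = (2 * k) * (2 * i))%N by lia.
  rewrite (mulnC 6).
  rewrite -!muln_modr eqn_pmul2l; last by lia.
  by case: i => i lt_i /= /eqP; lia.
have lt_s : (j %/ 6 < (#|F| - 1) %/ 6)%N by rewrite card_F; lia.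
by exists (Ordinal lt_s) => //=; rewrite -j_eq.
Qed.

Lemma card_cyclotomic_class (i : 'I_3) :
  #|cyclotomic_class alpha 6 (2 * i)| = (2 * k)%N.
Proof.
rewrite card_in_imset ?card_ord; first by rewrite card_F; lia.
move=> [s lt_s] [t lt_t] _ _ /= /eqP; apply: contraTeq.
rewrite (eq_prim_root_expr alpha_prim).
rewrite -(inj_eq val_inj) /=; move: lt_s lt_t; rewrite card_units card_F => ? ?.
case: i => i lt_i /=; rewrite !modn_small; lia.
Qed.

Lemma disjoint_cyclotomic_classes (i j : 'I_3) : i != j ->
  [disjoint cyclotomic_class alpha 6 (2 * i)
          & cyclotomic_class alpha 6 (2 * j)].
Proof.
apply: contraNT => /pred0Pn [x /andP[]] /=; rewrite !mem_cyclotomic_class.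
move=> /eqP -> /eqP/eqP; rewrite (eq_prim_root_expr zeta_prim).
by rewrite !modn_small.
Qed.

Lemma double_quad_char_indicator (x c : F) :
  c != 0 -> 2 * (chi x == chi c)%:R = (x != 0)%:R + chi c * chi x.
Proof.
move=> c_n0; have [->|x_n0] := eqVneq x 0; rewrite ?quad_char0.
  by case: (quad_char_cases c_n0) => ->.
by case: (quad_char_cases c_n0) => ->; case: (quad_char_cases x_n0) => ->.
Qed.

(** Each indicator is an affine function of [chi] away from zero, so only the
    correlation sum of [chi] at distance [g] is needed. *)
Lemma card_square_pairs (g : F) : g != 0 ->
  4 * (\sum_y (chi y == 1)%:R * (chi (y + g) == 1)%:R)
    = 12 * k%:R - 2 - 2 * chi g.
Proof.
move=> g_n0; have one_n0 : 1 != 0 :> F by rewrite oner_eq0.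
have ind x : 2 * (chi x == 1)%:R = 1 - (x == 0)%:R + chi x.
  have := double_quad_char_indicator x one_n0; rewrite quad_char1 mul1r => ->.
  by case: (x == 0).
rewrite mulr_sumr (eq_bigr (fun y => 1 - (y == - g)%:R * (1 + chi y)
    + chi (y + g) + chi y + chi y * chi (y + g)
    - (y == 0)%:R * (1 - (y == - g)%:R + chi (y + g)))) => [|y _].
  rewrite sumrB !big_split /= sumrN !sum_delta.
  rewrite (sum_quad_char_shift alpha_prim F_odd) //.
  rewrite -(reindex_inj (addIr g) (P := predT) (F := chi)) /=.
  rewrite !(sum_quad_char alpha_prim F_odd) chiN add0r.
  rewrite eq_sym oppr_eq0 (negPf g_n0) sumr_const card_F natrD natrM /=.
  by ring.
have -> : 4 * ((chi y == 1)%:R * (chi (y + g) == 1)%:R)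
  = (2 * (chi y == 1)%:R) * (2 * (chi (y + g) == 1)%:R) :> int by ring.
by rewrite !ind addr_eq0; ring.
Qed.

(** With [u = 1 + g / y], the elements [y] and [y + g] lie in one class iff
    [u ^+ (2 * k) = 1], and [y] is a square iff [chi (u - 1) = chi g].  The
    sixth powers [u] are then parametrized, six to one, by their roots. *)
Lemma card_same_class_pairs (g : F) : g != 0 ->
  12 * (\sum_y (chi y == 1)%:R * (y ^+ (2 * k) == (y + g) ^+ (2 * k))%:R)
    = 12 * k%:R - 6 + chi g * (2 * J 1 - 2).
Proof.
move=> g_n0.
have to_ratio : \sum_y (chi y == 1)%:R * (y ^+ (2 * k) == (y + g) ^+ (2 * k))%:R
  = (\sum_(u : F | u ^+ (2 * k) == 1) (chi (u - 1) == chi g)%:R)%R :> int.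
  rewrite (bigD1 0) //= quad_char0 mul0r add0r.
  rewrite [RHS]big_mkcond [RHS](bigD1 1) //= subrr quad_char0 expr1n eqxx.
  have -> : (0 == chi g) = false by case: (quad_char_cases g_n0) => ->.
  rewrite add0r -(sum_shifted_ratio _ g_n0); apply: eq_bigr => y y_n0.
  have -> : y + g = y * (1 + g / y) by rewrite mulrDr mulr1 mulrCA divff ?mulr1.
  rewrite [1 + _ - 1]addrAC subrr add0r chiM (quad_charV alpha_prim F_odd).
  rewrite exprMn -{1}[y ^+ _]mulr1 (inj_eq (mulfI _)) ?expf_neq0 //.
  rewrite [1 == _]eq_sym.
  case: (_ ^+ _ == 1); last by rewrite mulr0.
  rewrite mulr1.
  by case: (quad_char_cases y_n0) => ->; case: (quad_char_cases g_n0) => ->.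
rewrite {}to_ratio.
transitivity (6 * \sum_(u : F | u ^+ (2 * k) == 1)
    ((u - 1 != 0)%:R + chi g * chi (u - 1))).
  under [in RHS]eq_bigr => u _ do rewrite -(double_quad_char_indicator _ g_n0).
  by rewrite -mulr_sumr; ring.
rewrite mulr_natl -(sum_power_map alpha_prim
  (fun u => (u - 1 != 0)%:R + chi g * chi (u - 1)) card_6).
rewrite big_split /= -mulr_sumr (sum_quad_char_sextic alpha_prim F_odd dvd4).
congr (_ + _).
have one_n0 : 1 != 0 :> F by rewrite oner_eq0.
have := card_same_power alpha_prim card_6 one_n0; rewrite expr1n.
have := card_nonzero alpha_prim.
have -> : (\sum_(v : F | v != 0) (v ^+ 6 - 1 != 0)%:R)%R
  = (#|[pred v : F | v != 0]|%:R - #|[pred v : F | v ^+ 6 == 1]|%:R)%R :> int.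
  rewrite -!sum_indicator big_mkcond -sumrB; apply: eq_bigr => v _ /=.
  have [->|_] := eqVneq v 0; rewrite subr_eq0.
    by rewrite expr0n eq_sym oner_eq0.
  by case: (_ == 1).
by move=> -> ->; rewrite card_units natrM.
Qed.

Lemma class_index (x : F) : chi x = 1 ->
  exists i : 'I_3, forall j : 'I_3, (x ^+ (2 * k) == zeta ^+ j) = (j == i).
Proof.
move=> /eqP; rewrite (quad_char_eq1 alpha_prim F_odd) half_F => x_pow.
have /(prim_rootP zeta_prim) [i ->] : (x ^+ (2 * k)) ^+ 3 = 1.
  by rewrite -exprM (_ : 2 * k * 3 = 6 * k)%N ?(eqP x_pow) //; lia.
exists i => j; rewrite (eq_prim_root_expr zeta_prim) !modn_small //.
by rewrite eq_sym.
Qed.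

Lemma no_class_index (x : F) (j : 'I_3) :
  chi x != 1 -> (x ^+ (2 * k) == zeta ^+ j) = false.
Proof.
rewrite (quad_char_eq1 alpha_prim F_odd) half_F; apply: contraNF => /eqP x_pow.
rewrite (_ : 6 * k = 2 * k * 3)%N; last by lia.
by rewrite exprM x_pow exprAC (prim_expr_order zeta_prim) expr1n.
Qed.

Lemma sum_distinct_classes (y z : F) :
  \sum_(i < 3) \sum_(j < 3 | i != j) (y \in D j)%:R * (z \in D i)%:R
    = (chi y == 1)%:R * (chi z == 1)%:R
      - (chi y == 1)%:R * (y ^+ (2 * k) == z ^+ (2 * k))%:R :> int.
Proof.
under eq_bigr => i _ do under eq_bigr => j _ do rewrite !mem_cyclotomic_class.
have [y1|y_n1] := eqVneq (chi y) 1; last first.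
  rewrite !mul0r subrr big1 // => i _; rewrite big1 // => j _.
  by rewrite no_class_index ?mul0r.
have [a a_P] := class_index y1.
have [z1|z_n1] := eqVneq (chi z) 1; last first.
  have /eqP -> : y ^+ (2 * k) == zeta ^+ a by rewrite a_P.
  rewrite [zeta ^+ a == _]eq_sym no_class_index // !mulr0 subrr big1 // => i _.
  by rewrite big1 // => j _; rewrite no_class_index ?mulr0.
have [b b_P] := class_index z1.
have z_eq : z ^+ (2 * k) = zeta ^+ b by apply/eqP; rewrite b_P.
rewrite [in RHS]z_eq a_P (bigD1 b) //= [X in _ + X]big1 => [|i /negPf i_b].
  under eq_bigr => j _ do rewrite a_P b_P eqxx mulr1.
  have [->|b_a] := eqVneq b a.
    by rewrite big1 // => j; rewrite eq_sym => /negPf ->.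
  by rewrite (bigD1 a) //= eqxx big1 // => j /andP[_ /negPf ->].
by rewrite big1 // => j _; rewrite b_P i_b mulr0.
Qed.

(** The pairs of squares at distance [g], minus those lying in one class. *)
Lemma multiplicity_formula (g : F) : g != 0 ->
  6 * (\sum_(i < 3) \sum_(j < 3 | i != j)
         count_mem g (Delta (D i) (D j)))%N%:R
    = (12 * k%:R - chi g * (J 1 + 2))%R :> int.
Proof.
move=> g_n0; rewrite natr_sum.
under eq_bigr => i _ do rewrite natr_sum.
under eq_bigr => i _ do under eq_bigr => j _ do rewrite count_mem_Delta.
under eq_bigr => i _ do rewrite exchange_big /=.
rewrite exchange_big /=.
under eq_bigr => y _ do rewrite sum_distinct_classes.
rewrite sumrB.
have := card_square_pairs g_n0; have := card_same_class_pairs g_n0.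
move: (\sum_y _) (\sum_y _) => M P; lia.
Qed.

(** As [chi g] is never zero, a single [g] already forces [J 1 = -2]. *)
Lemma is_EDF_iff_jacobsthal : is_EDF #|F| 3 (2 * k) (2 * k) D <-> J 1 = -2.
Proof.
split=> [[_ _ _ edf] | J1].
  have one_n0 : 1 != 0 :> F by rewrite oner_eq0.
  have := multiplicity_formula one_n0; rewrite (edf 1 one_n0) quad_char1 natrM.
  by move: (J 1) (k%:R : int) => a r; lia.
split=> // [i | i j | g g_n0]; first exact: card_cyclotomic_class.
  exact: disjoint_cyclotomic_classes.
have := multiplicity_formula g_n0; rewrite J1 addNr mulr0 subr0.
by move: (\sum_(i < 3) _)%N => N; rewrite !natz; lia.
Qed.

End SexticClasses.

Lemma primitive_element_root (F : finFieldType) (alpha : F) :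
  primitive_element alpha -> #|F|.-1.-primitive_root alpha.
Proof.
move=> [u -> /eqP gen_u].
have ord_u : #[u]%g = #|F|.-1 by rewrite orderE -gen_u card_finField_unit.
apply/andP; split; first by rewrite -ord_u order_gt0.
apply/forallP => i; rewrite unity_rootE.
rewrite -FinRing.val_unitX -(FinRing.val_unit1 F) (inj_eq val_inj).
rewrite -order_dvdn ord_u; apply/eqP; apply/idP/eqP => [/dvdn_leq i_ge|-> //].
by apply/eqP; rewrite eqn_leq ltn_ord i_ge.
Qed.

Theorem theorem4p2 (p k : nat) (alpha : 'F_p)
    (hk : (0 < k)%N) (hp : p = (12 * k + 1)%N) (p_prime : prime p)
    (halpha : primitive_element alpha) :
  is_EDF p 3 ((p - 1) %/ 6) ((p - 1) %/ 6)
    (fun i : 'I_3 => cyclotomic_class alpha 6 (2 * i))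
  <-> exists a : int, k%:Z = a ^+ 2.
Proof.
have alpha_prim := primitive_element_root halpha.
have card_F : #|'F_p| = (12 * k + 1)%N by rewrite card_Fp.
have F_odd : odd #|'F_p| by rewrite card_F; lia.
have card_3 : (3 * (4 * k))%N = #|'F_p|.-1 by rewrite card_F; lia.
have [e norm_p] := cubic_jacobsthal_norm alpha_prim F_odd card_3.
rewrite card_Fp // (natz p) in norm_p.
have mod6 := cubic_jacobsthal1_mod6 alpha_prim F_odd card_3.
have -> : ((p - 1) %/ 6 = 2 * k)%N by lia.
rewrite -(eq_m2_iff_square p_prime hp mod6 norm_p).
by rewrite -(is_EDF_iff_jacobsthal alpha_prim card_F) card_Fp.
Qed.
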